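(* Let $X$ be any countable domain, let $c\subseteq X$ be any concept, and let $\mathcal{H}\subseteq 2^X$ be a hypothesis class over $X$ with finite VC dimension. Then: 1. $c$ is approximable by $\mathcal{H}$ if and only if $c\in\sigma(\mathcal{H})$. 2. $c$ is approximable but not interpretable by $\mathcal{H}$ if and only if $c\in\sigma(\mathcal{H})\setminus\mathrm{Alg}(\mathrm{clos}(\mathcal{H}))$. 3. $c$ is uniformly interpretable by $\mathcal{H}$ if and only if $c\in\mathrm{Alg}(\mathrm{clos}(\mathcal{H}))$.
   Context: Fix a $\sigma$-algebra on $X$; $\mathcal{P}(X)$ is the set of all probability distributions on $X$ with this $\sigma$-algebra. All concepts and hypotheses (subsets of $X$, identified with their indicator functions $X\to\{0,1\}$) are assumed measurable. For a family $\mathcal{G}$ of subsets of $X$: $\mathrm{Alg}(\mathcal{G})$ is the smallest family of subsets of $X$ that contains $\mathcal{G}$, $\emptyset$ and $X$ and is closed under complements and finite unions; $\sigma(\mathcal{G})$ is the smallest such family that is moreover closed under countable unions; and $$\mathrm{clos}(\mathcal{G})=\{h\subseteq X:\ \forall P\in\mathcal{P}(X)\ \exists h_1,h_2,\ldots\in\mathcal{G}\ \text{such that}\ \lim_{n\to\infty}P(h\triangle h_n)=0\}.$$ An $\mathcal{H}$-based decision tree is a finite full binary tree $T$ in which every leaf holds a label in $\{0,1\}$ and every internal node $v$ holds a function $f_v\in\mathcal{H}$; a point $x$ is routed from the root to a leaf, going at node $v$ to the child determined by $f_v(x)$, and $T(x)$ is the label of the leaf reached. $\mathrm{depth}(T)$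 is the height of $T$ (a single leaf has depth $0$). For $P\in\mathcal{P}(X)$ let $L_P(T,c)=\Pr_{x\sim P}(T(x)\neq c(x))$, and let $$\mathrm{depth}^c_{\mathcal{H}}(\varepsilon\mid P)=\inf\{\mathrm{depth}(T): T \text{ an } \mathcal{H}\text{-based decision tree with } L_P(T,c)\le\varepsilon\}\quad(\inf\emptyset=\infty).$$ $c$ is approximable by $\mathcal{H}$ if for every $P\in\mathcal{P}(X)$ and every $\varepsilon>0$ there exists an $\mathcal{H}$-based decision tree $T$ with $L_P(T,c)\le\varepsilon$. $c$ is interpretable by $\mathcal{H}$ if there is a function $f:(0,1]\to\mathbb{N}$ such that for every $P\in\mathcal{P}(X)$ there exists $\varepsilon_P>0$ with $\mathrm{depth}^c_{\mathcal{H}}(\varepsilon\mid P)\le f(\varepsilon)$ for all $0<\varepsilon\le\varepsilon_P$. $c$ is uniformly interpretable by $\mathcal{H}$ if there is a function $f':(0,1]\to\mathbb{N}$ such that $\mathrm{depth}^c_{\mathcal{H}}(\varepsilon\mid P)\le f'(\varepsilon)$ for all $P\in\mathcal{P}(X)$ and all $0<\varepsilon\le 1$. *)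

(* Defs.v *)
From HB Require Import structures.
From mathcomp Require Import all_boot all_order all_algebra.
From mathcomp Require Import all_classical all_reals all_analysis.
Import Order.TTheory GRing.Theory Num.Theory.
Import numFieldNormedType.Exports.

Set Implicit Arguments.
Unset Strict Implicit.
Unset Printing Implicit Defensive.

Local Open Scope classical_set_scope.
Local Open Scope ring_scope.
Local Open Scope ereal_scope.

(* Concepts and hypotheses are sets; [x \in h] is the {0,1}-valued indicator
   function of [h] at [x]. *)

Definition set_algebra (T : Type) (G : set (set T)) : Prop :=
  [/\ G set0, G setT, setC_closed G & setU_closed G].

Definition Alg (T : Type) (G : set (set T)) : set (set T) :=
  smallest (@set_algebra T) G.

Definition clos (R : realType) (d : measure_display) (X : measurableType d)
    (G : set (set X)) : set (set X) :=
  [set h | measurable h /\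
    forall P : probability X R, exists h_ : nat -> set X,
      (forall n, G (h_ n)) /\ P (h `+` h_ n) @[n --> \oo] --> 0].

Definition shatters (T : Type) (H : set (set T)) (S : set T) : Prop :=
  forall B, B `<=` S -> exists2 h, H h & h `&` S = B.

(* Supremum of the sizes of the finite shattered sets; [-oo] if [H] is empty. *)
Definition VCdim (R : realType) (T : Type) (H : set (set T)) : \bar R :=
  ereal_sup [set n%:R%:E | n in
    [set n : nat | exists2 S : set T, (S #= `I_n)%card & shatters H S]].

(* [Node f t1 t0] sends [x] to [t1] when [x \in f] and to [t0] otherwise. *)
Inductive dtree (T : Type) : Type :=
| Leaf of bool
| Node of set T & dtree T & dtree T.

Fixpoint dtree_eval (T : Type) (t : dtree T) (x : T) : bool :=
  match t with
  | Leaf b => b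
  | Node f t1 t0 => if x \in f then dtree_eval t1 x else dtree_eval t0 x
  end.

Fixpoint dtree_depth (T : Type) (t : dtree T) : nat :=
  match t with
  | Leaf _ => 0%N
  | Node _ t1 t0 => (maxn (dtree_depth t1) (dtree_depth t0)).+1
  end.

Fixpoint dtree_based (T : Type) (H : set (set T)) (t : dtree T) : Prop :=
  match t with
  | Leaf _ => True
  | Node f t1 t0 => [/\ H f, dtree_based H t1 & dtree_based H t0]
  end.

Definition loss (R : realType) (d : measure_display) (X : measurableType d)
    (P : probability X R) (t : dtree X) (c : set X) : \bar R :=
  P [set x | dtree_eval t x != (x \in c)].

Definition depth_at (R : realType) (d : measure_display) (X : measurableType d)
    (H : set (set X)) (c : set X) (e : R) (P : probability X R) : \bar R :=
  ereal_inf [set (dtree_depth t)%:R%:E | t in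
    [set t : dtree X | dtree_based H t /\ loss P t c <= e%:E]].

Definition approximable (R : realType) (d : measure_display)
    (X : measurableType d) (H : set (set X)) (c : set X) : Prop :=
  forall (P : probability X R) (e : R), (0 < e)%R ->
    exists t : dtree X, dtree_based H t /\ loss P t c <= e%:E.

(* Rate functions on (0, 1] are represented by functions on [R] that are only
   ever used on (0, 1]; this is why the threshold [eP] is taken in (0, 1]. *)
Definition interpretable (R : realType) (d : measure_display)
    (X : measurableType d) (H : set (set X)) (c : set X) : Prop :=
  exists f : R -> nat, forall P : probability X R,
    exists2 eP : R, (0 < eP <= 1)%R &
      forall e : R, (0 < e <= eP)%R -> depth_at H c e P <= (f e)%:R%:E.

Definition uniformly_interpretable (R : realType) (d : measure_display)
    (X : measurableType d) (H : set (set X)) (c : set X) : Prop :=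
  exists f : R -> nat, forall (P : probability X R) (e : R),
    (0 < e <= 1)%R -> depth_at H c e P <= (f e)%:R%:E.

(* Main.v *)
Require Import Defs.
From HB Require Import structures.
From mathcomp Require Import all_boot all_order all_algebra.
From mathcomp Require Import all_classical all_reals all_analysis.
From mathcomp Require Import ring lra zify.
Import Order.TTheory GRing.Theory Num.Theory.
Import numFieldNormedType.Exports.

(** The heart of the matter is that an interpretable [c] lies in
    [Alg (clos H)]. Mixing hard distributions shows that interpretability
    already gives, for each accuracy, one depth [n] valid for all [P]. On a
    finite set of points, multiplicative weights then produce arbitrarily many
    trees of depth [n] of which at least three quarters are right at each point.
    The dual class of [H] has finite VC dimension, so [m] such trees behave in
    only polynomially many (in [m]) ways, and a derandomized halving of the
    family loses little at each stage: one may descend to a number of trees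
    depending only on [n] and [H], still with a correct strict majority
    everywhere. Hence boundedly many sets of [H] determine [c] on any finite set;
    an ultrafilter limit yields finitely many sets, in the pointwise closure of
    [H] (with the empty set), that determine [c] on all of [X]. As [X] is
    countable, the pointwise closure of [H] is contained in [clos H]. *)

Local Open Scope classical_set_scope.
Local Open Scope ring_scope.

(** * Dual Sauer-Shelah bound *)

Definition mask_shattered (V : seq (seq bool)) (m : seq bool) : Prop :=
  forall w, size w = count id m -> exists2 v, v \in V & mask m v = w.

(** Induction on the length: [size V] is the number of tails extended by at least one letter plus
    the number extended by both. A mask shattered by the latter stays shattered in [V] after the
    first coordinate is added, so there [D] drops by one. *)
Lemma sauer_shelah (n D : nat) (V : seq (seq bool)) :
  uniq V -> (forall v, v \in V -> size v = n) ->
  (forall m, size m = n -> count id m = D -> ~ mask_shattered V m) ->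
  (size V <= n.+1 ^ D)%N.
Proof.
elim: n D V => [|n IHn] D V uV szV shV.
  rewrite exp1n; case: V uV szV {shV} => [|u [|v V]] //= /andP[+ _] szV.
  rewrite inE (size0nil (szV u _)) ?inE ?eqxx// (size0nil (szV v _)) //.
  by rewrite !inE eqxx orbT.
case: D shV => [|D] shV.
  case: V uV szV shV => [//|v V] _ szV /(_ (nseq n.+1 false)).
  case; rewrite ?size_nseq ?count_nseq// => w; rewrite count_nseq => /size0nil->.
  by exists v; rewrite ?mem_head// mask_false.
pose Vb b := [seq behead v | v <- V & head false v == b].
have Vb_in b v : (v \in Vb b) = ((b :: v) \in V).
  apply/mapP/idP => [[u]|bvV].
    rewrite mem_filter => /andP[/eqP hu uV'] ->.
    by case: u hu uV' (szV u uV') => //= ? u -> .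
  by exists (b :: v) => //; rewrite mem_filter /= eqxx.
have uVb b : uniq (Vb b).
  rewrite map_inj_in_uniq ?filter_uniq// => u v; rewrite !mem_filter.
  move=> /andP[/eqP hu /szV su] /andP[/eqP hv /szV sv].
  by case: u hu su => //= ? u -> _; case: v hv sv => //= ? v -> _ ->.
have szVb b v : v \in Vb b -> size v = n by rewrite Vb_in => /szV[].
have sV : size V = (size (Vb true) + size (Vb false))%N.
  rewrite !size_map !size_filter -(count_predC (fun v => head false v == true)).
  by congr addn; apply: eq_count => v /=; case: head.
pose I := [seq v <- Vb true | v \in Vb false].
pose U := Vb true ++ [seq v <- Vb false | v \notin Vb true].
have sUI : size V = (size U + size I)%N.
  rewrite sV size_cat -addnA; congr addn.
  rewrite -(count_predC (fun v => v \in Vb true) (Vb false)) addnC -!size_filter.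
  congr addn; apply: perm_size; apply: uniq_perm; rewrite ?filter_uniq// => v.
  by rewrite !mem_filter andbC.
have U_in v : (v \in U) = (v \in Vb true) || (v \in Vb false).
  by rewrite mem_cat mem_filter; case: (v \in Vb true).
rewrite sUI (@leq_trans (n.+1 ^ D.+1 + n.+1 ^ D))//; last first.
  rewrite expnS -mulSnr expnS leq_mul//.
  by case: (D) => // D'; rewrite leq_exp2r.
apply: leq_add; apply: IHn.
- rewrite cat_uniq uVb filter_uniq// andbT; apply/hasPn => v.
  by rewrite mem_filter => /andP[].
- by move=> v; rewrite U_in => /orP[] /szVb.
- move=> m sm cm shm; apply: (shV (false :: m)) => /=; rewrite ?sm ?cm//.
  move=> w /shm[v]; rewrite U_in => /orP[]; rewrite Vb_in => vV <-.
    by exists (true :: v).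
  by exists (false :: v).
- by rewrite filter_uniq.
- by move=> v; rewrite mem_filter => /andP[_ /szVb].
- move=> m sm cm shm; apply: (shV (true :: m)) => /=; rewrite ?sm ?cm//.
  move=> [//|b w] [] /shm[v]; rewrite mem_filter !Vb_in => /andP[vF vT] <-.
  by exists (b :: v); case: b.
Qed.

Definition pattern {T : Type} (hs : seq (set T)) (x : T) : seq bool :=
  [seq x \in h | h <- hs].

(** Index the [2 ^ r] sets by the subsets of ['I_r] and pick for each [i] a point lying in exactly
    the sets whose index contains [i]: these [r] distinct points are shattered by [H]. *)
Lemma dual_not_mask_shattered {T : Type} (H : set (set T)) (r : nat)
    (nsh : forall S : set T, (S #= `I_r)%card -> ~ shatters H S)
    (hs : seq (set T)) (Hhs : forall h, h \in hs -> H h) (Y : set T) :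
  size hs = (2 ^ r)%N ->
  ~ (forall w, size w = (2 ^ r)%N -> exists2 x, Y x & pattern hs x = w).
Proof.
move=> shs sh.
pose E := enum (powerset [set: 'I_r]).
have sE : size E = (2 ^ r)%N by rewrite -cardE card_powerset cardsT card_ord.
have /choice[x xP] (i : 'I_r) : exists x, pattern hs x = [seq i \in A | A : {set 'I_r} <- E].
  by have [|x _ xP] := sh [seq i \in A | A : {set 'I_r} <- E]; [rewrite size_map|exists x].
have in_E (A : {set 'I_r}) : A \in E by rewrite mem_enum powersetE finset.subsetT.
have in_h (A : {set 'I_r}) i : (x i \in nth set0 hs (index A E)) = (i \in A).
  have lt : (index A E < 2 ^ r)%N by rewrite -sE index_mem.
  have := congr1 (fun s => nth false s (index A E)) (xP i).
  by rewrite (nth_map set0) ?shs// (nth_map A) ?sE// nth_index// => ->.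
have x_inj : injective x.
  move=> i j xij; apply/eqP.
  by have := in_h [set j]%SET i; rewrite xij in_h !finset.in_set1 eqxx => <-.
apply: (nsh (range x)).
  rewrite (card_eql (inj_card_eq (in2W x_inj))) card_eq_sym.
  exact: card_II.
move=> B BS.
pose A : {set 'I_r} := [set i | x i \in B]%SET.
exists (nth set0 hs (index A E)).
  by apply: Hhs; apply: mem_nth; rewrite shs -sE index_mem.
apply/seteqP; split => y /=.
  by move=> [+ [i _ xi]]; rewrite -xi -in_setE in_h inE in_setE.
move=> yB; have [i _ xi] := BS _ yB; split; last by exists i.
by rewrite -xi -in_setE in_h inE xi in_setE.
Qed.

(** One point is kept per pattern realized on [Y]; the dual bound makes their number polynomial in
    [size hs]. *)
Lemma representatives {T : choiceType} (H : set (set T)) (r : nat)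
    (nsh : forall S : set T, (S #= `I_r)%card -> ~ shatters H S)
    (hs : seq (set T)) (Hhs : forall h, h \in hs -> H h) (Y : set T) :
  exists L : seq T, (size L <= (size hs).+1 ^ (2 ^ r))%N /\
    forall x, Y x -> exists2 y, y \in L & Y y /\ pattern hs y = pattern hs x.
Proof.
pose realized (v : seq bool) := exists2 x, Y x & pattern hs x = v.
pose V := [seq val v | v : (size hs).-tuple bool <-
  enum {: (size hs).-tuple bool} & `[< realized (val v) >]].
have V_real v : v \in V -> realized v.
  by move=> /mapP[t]; rewrite mem_filter => /andP[/asboolP rv _] ->.
have VY x : Y x -> pattern hs x \in V.
  move=> Yx; have sx : size (pattern hs x) == size hs by rewrite size_map.
  apply/mapP; exists (Tuple sx) => //; rewrite mem_filter mem_enum andbT.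
  by apply/asboolP; exists x.
have [L [sL LP]] : exists L : seq T, size L = size V /\
    forall v, v \in V -> exists2 y, y \in L & Y y /\ pattern hs y = v.
  elim: V V_real {VY} => [|v V IH] realV; first by exists [::].
  have [|L [sL LP]] := IH; first by move=> u uV; apply: realV; rewrite inE uV orbT.
  have [x Yx xv] := realV v (mem_head _ _).
  exists (x :: L); split; first by rewrite /= sL.
  move=> u; rewrite inE => /orP[/eqP->|/LP[y yL yP]]; first by exists x; rewrite ?mem_head.
  by exists y; rewrite // inE yL orbT.
exists L; split; last by move=> x /VY/LP.
rewrite sL; apply: sauer_shelah.
- rewrite map_inj_uniq; last by move=> ? ? /val_inj.
  by apply: filter_uniq; exact: enum_uniq.
- by move=> v /mapP[t _ ->]; rewrite size_tuple.
move=> m sm cm shm; pose hs' := mask m hs.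
have mask_pattern x : mask m (pattern hs x) = pattern hs' x by rewrite /pattern -map_mask.
apply: (@dual_not_mask_shattered T H r nsh hs' _ Y).
- by move=> h /mem_mask/Hhs.
- by rewrite size_mask.
move=> w sw; have [|v /V_real[x Yx <-] <-] := shm w; first by rewrite sw cm.
by exists x.
Qed.

(** * Sparsifying families of trees *)

(** Families are infinite sequences of which an initial segment counts, so that shifting and
    updating carry no length conditions. *)
Definition errs {A T : Type} (bad : A -> T -> bool) (s : nat -> A) (n : nat) (x : T) : nat :=
  (\sum_(i < n) bad (s i) x)%N.

Lemma bernoulli_ineq {R : realFieldType} (y : R) (n : nat) :
  -1 <= y -> 1 + y * n%:R <= (1 + y) ^+ n.
Proof.
move=> y1; elim: n => [|n IH]; first by rewrite mulr0 addr0 expr0.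
rewrite exprS; apply: le_trans (ler_wpM2l _ IH); last by lra.
rewrite -natr1; have := mulr_ge0 (sqr_ge0 y) (ler0n R n); lra.
Qed.

(* Choosing one element of each pair [a i, a' i] at random, the potential
   [b ^ errs s / b ^ errs u] has mean at most [((b + 1/b) / 2) ^ M]. *)
Lemma derandomized_split {A T : Type} {R : realFieldType} (bad : A -> T -> bool)
    (a a' : nat -> A) (L : seq T) (b : R) (M : nat) : 0 < b ->
  exists s u : nat -> A,
    (forall i, s i = a i /\ u i = a' i \/ s i = a' i /\ u i = a i) /\
    \sum_(x <- L) b ^+ errs bad s M x / b ^+ errs bad u M x <=
      ((b + b^-1) / 2) ^+ M * (size L)%:R.
Proof.
move=> b0; elim: M => [|M [s [u [su le]]]].
  exists a, a'; split; first by left.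
  rewrite expr0 mul1r -sum1_size natr_sum; apply: ler_sum => x _.
  by rewrite /errs !big_ord0 expr0 divr1.
pose W x := b ^+ errs bad s M x / b ^+ errs bad u M x.
pose g t v x := b ^+ bad t x / b ^+ bad v x : R.
have W0 x : 0 <= W x by rewrite divr_ge0// exprn_ge0// ltW.
pose upd (f : nat -> A) v i := if i == M then v else f i.
have updE f g' v v' x : b ^+ errs bad (upd f v) M.+1 x / b ^+ errs bad (upd g' v') M.+1 x =
    b ^+ errs bad f M x / b ^+ errs bad g' M x * g v v' x.
  have E h w : errs bad (upd h w) M.+1 x = (errs bad h M x + bad w x)%N.
    rewrite /errs big_ord_recr /= /upd eqxx; congr addn; apply: eq_bigr => i _.
    by rewrite ltn_eqF.
  by rewrite !E !exprD invfM /g mulrACA.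
have sum2 : \sum_(x <- L) W x * g (a M) (a' M) x + \sum_(x <- L) W x * g (a' M) (a M) x
    <= (b + b^-1) * \sum_(x <- L) W x.
  rewrite -big_split/= mulr_sumr; apply: ler_sum => x _.
  rewrite -mulrDr mulrC; apply: ler_wpM2r => //.
  (* This covers the points where [a M] and [a' M] are both bad or both good and the two factors add
     up to [2]; elsewhere they add up to [b + b^-1]. *)
  have b2 : 2 <= b + b^-1.
    have -> : b + b^-1 = 2 + (b - 1) ^+ 2 / b by field; rewrite gt_eqF.
    by rewrite lerDl divr_ge0 ?sqr_ge0// ltW.
  by rewrite /g; case: (bad (a M) x); case: (bad (a' M) x);
     rewrite ?expr0 ?expr1 ?divr1 ?mul1r ?divff ?gt_eqF// addrC.
have su' w w' : (w = a M /\ w' = a' M \/ w = a' M /\ w' = a M) ->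
    forall i, upd s w i = a i /\ upd u w' i = a' i \/ upd s w i = a' i /\ upd u w' i = a i.
  by move=> ww i; rewrite /upd; case: eqP => [->|_].
have b20 : 0 <= (b + b^-1) / 2 by rewrite divr_ge0// addr_ge0// ?invr_ge0 ltW.
have step w w' : \sum_(x <- L) W x * g w w' x <= (b + b^-1) / 2 * \sum_(x <- L) W x ->
    \sum_(x <- L) b ^+ errs bad (upd s w) M.+1 x / b ^+ errs bad (upd u w') M.+1 x <=
      ((b + b^-1) / 2) ^+ M.+1 * (size L)%:R.
  move=> le1; under eq_bigr do rewrite updE.
  by apply: le_trans le1 _; move: b20 le; set k := _ / 2 => k0 ?; rewrite exprS -mulrA ler_wpM2l.
(* By [sum2] one of the two ways to assign the new pair is no worse than their average; taking it
   replaces the random choice. *)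
have [le1|gt1] := leP (\sum_(x <- L) W x * g (a M) (a' M) x) ((b + b^-1) / 2 * \sum_(x <- L) W x).
  exists (upd s (a M)), (upd u (a' M)); split; [by apply: su'; left|exact: step].
exists (upd s (a' M)), (upd u (a M)); split; [by apply: su'; right|apply: step; lra].
Qed.

(** Index [i] is paired with [M + i]. The kept and discarded halves share the errors of [s], so it
    suffices to bound their difference; a point where it exceeded [4 * n * q] would alone outweigh
    the bound on the potential. *)
Lemma halving {A : Type} {T : choiceType} (bad : A -> T -> bool)
    (s : nat -> A) (L : seq T) (n q : nat) :
  (0 < n)%N -> (size L < 4 ^ q)%N ->
  exists s' : nat -> A,
    (forall i, exists2 j, (i < n ^ 2 * q)%N -> (j < 2 * (n ^ 2 * q))%N & s' i = s j) /\
    forall x, x \in L ->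
      (2 * errs bad s' (n ^ 2 * q) x <= errs bad s (2 * (n ^ 2 * q)) x + 4 * n * q)%N.
Proof.
move=> n0 sL; set M := (n ^ 2 * q)%N.
have nR : 1 <= n%:R :> rat by rewrite ler1n.
(* Large enough for [b ^+ n >= 2], small enough for the growth factor [k] to satisfy
   [k ^+ (n ^ 2) <= 2]. *)
pose b : rat := 1 + n%:R^-1.
have b1 : 1 < b by rewrite ltrDl invr_gt0; lra.
have b0 : 0 < b by lra.
have bn : 2 <= b ^+ n.
  apply: le_trans (bernoulli_ineq _ _ _); first by rewrite mulVf; lra.
  by have : 0 < n%:R^-1 :> rat; [rewrite invr_gt0; lra|lra].
pose k : rat := (b + b^-1) / 2.
have k1 : 1 <= k.
  have -> : k = 1 + (b - 1) ^+ 2 / (2 * b) by rewrite /k; field; rewrite gt_eqF.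
  by rewrite lerDl divr_ge0 ?sqr_ge0//; lra.
have kn : k ^+ (n ^ 2) <= 2.
  (* As [k * (1 - y) <= 1], it is enough that [(1 - y) ^+ (n ^ 2) >= 1 / 2], which is the Bernoulli
     inequality since [y * n ^ 2 = 1 / 2]. *)
  pose y : rat := (2 * n%:R ^+ 2)^-1.
  have n2 : 1 <= n%:R ^+ 2 :> rat by rewrite exprn_ege1.
  have y0 : 0 < y by rewrite invr_gt0; lra.
  have y1 : y <= 2^-1 by rewrite lef_pV2 ?posrE; lra.
  have ky : k <= 1 + y.
    have -> : k = 1 + (2 * (n%:R * (1 + n%:R)))^-1.
      by rewrite /k /b; field; rewrite !gt_eqF//; lra.
    by rewrite lerD2l lef_pV2 ?posrE; nra.
  have : (k * (1 - y)) ^+ (n ^ 2) <= 1 by rewrite exprn_ile1//; nra.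
  have : 1 / 2 <= (1 - y) ^+ (n ^ 2).
    apply: le_trans (bernoulli_ineq _ _ _); last by lra.
    rewrite natrX mulNr (_ : y * _ = 1 / 2); first by lra.
    by rewrite /y; field; rewrite gt_eqF//; lra.
  rewrite exprMn => h1 h2.
  have : 0 <= k ^+ (n ^ 2) by rewrite exprn_ge0; lra.
  nra.
have [s' [u [su pot]]] := derandomized_split bad s (fun i => s (M + i)%N) L b M b0.
exists s'; split.
  by move=> i; case: (su i) => -[-> _]; [exists i|exists (M + i)%N];
    rewrite // -/M mul2n -addnn ?ltn_add2l// => /ltn_addr.
move=> x xL.
have tot : (errs bad s' M x + errs bad u M x = errs bad s (2 * M) x)%N.
  rewrite /errs mul2n -addnn big_split_ord/= -!big_split/=; apply: eq_bigr => i _.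
  by case: (su i) => -[-> ->] //; rewrite addnC.
rewrite -tot mul2n -addnn -addnA leq_add2l.
rewrite leqNgt; apply/negP => lt.
have : b ^+ errs bad s' M x / b ^+ errs bad u M x <= k ^+ M * (size L)%:R.
  apply: le_trans pot; rewrite (big_rem x)//= lerDl sumr_ge0// => y _.
  by rewrite divr_ge0// exprn_ge0// ltW.
rewrite ler_pdivrMr ?exprn_gt0// leNgt => /negP; apply.
apply: (@lt_le_trans _ _ (b ^+ (errs bad u M x + 4 * n * q))); last first.
  by rewrite ler_eXn2l// ltnW.
rewrite exprD mulrC ltr_pM2l ?exprn_gt0//.
have q2 : k ^+ M <= 2 ^+ q by rewrite exprM lerXn2r ?nnegrE// exprn_ge0; lra.
apply: (@le_lt_trans _ _ (2 ^+ q * (size L)%:R)); first by rewrite ler_wpM2r.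
apply: (@lt_le_trans _ _ (2 ^+ q * 4 ^+ q)).
  by rewrite ltr_pM2l ?exprn_gt0// -natrX ltr_nat.
rewrite -exprMn [leRHS](_ : _ = ((b ^+ n) ^+ 4) ^+ q); last first.
  by rewrite -!exprM; congr (_ ^+ _); rewrite [RHS]mulnCA mulnA.
have b4 : 2 ^+ 4 <= (b ^+ n) ^+ 4 by rewrite lerXn2r ?nnegrE// exprn_ge0// ltW.
by rewrite lerXn2r ?nnegrE ?exprn_ge0 ?ltW//; lra.
Qed.

Lemma eq_patternP {T : Type} (hs : seq (set T)) (x y : T) :
  pattern hs x = pattern hs y <-> {in hs, forall h, (x \in h) = (y \in h)}.
Proof. by split=> [/eq_in_map|/eq_in_map]. Qed.

Fixpoint dtree_tests {T : Type} (t : dtree T) : seq (set T) :=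
  match t with
  | Leaf _ => [::]
  | Node f t1 t0 => f :: dtree_tests t1 ++ dtree_tests t0
  end.

Lemma size_dtree_tests {T : Type} (t : dtree T) :
  (size (dtree_tests t) < 2 ^ dtree_depth t)%N.
Proof.
elim: t => [//|f t1 IH1 t0 IH0] /=; rewrite size_cat expnS mul2n -addnn.
have : (2 ^ dtree_depth t1 <= 2 ^ maxn (dtree_depth t1) (dtree_depth t0))%N.
  by rewrite leq_exp2l// leq_maxl.
have : (2 ^ dtree_depth t0 <= 2 ^ maxn (dtree_depth t1) (dtree_depth t0))%N.
  by rewrite leq_exp2l// leq_maxr.
lia.
Qed.

Lemma dtree_based_tests {T : Type} (H : set (set T)) (t : dtree T) :
  dtree_based H t -> forall h, h \in dtree_tests t -> H h.
Proof.
elim: t => [//|f t1 IH1 t0 IH0] /= [Hf /IH1{}IH1 /IH0{}IH0] h.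
by rewrite inE mem_cat => /orP[/eqP->//|/orP[/IH1|/IH0]].
Qed.

Lemma eq_dtree_eval {T : Type} (t : dtree T) (x y : T) :
  {in dtree_tests t, forall h, (x \in h) = (y \in h)} ->
  dtree_eval t x = dtree_eval t y.
Proof.
elim: t => [//|f t1 IH1 t0 IH0] /= xy.
rewrite xy ?mem_head// IH1 ?IH0// => h ht; apply: xy;
  by rewrite inE mem_cat ht ?orbT.
Qed.

Definition misclassifies {T : Type} (c : set T) (t : dtree T) (x : T) : bool :=
  dtree_eval t x != (x \in c).

Definition family_tests {T : Type} (s : nat -> dtree T) (n : nat) : seq (set T) :=
  flatten [seq dtree_tests (s i) | i <- iota 0 n].

Lemma mem_family_tests {T : Type} (s : nat -> dtree T) (n : nat) h :
  reflect (exists2 i, (i < n)%N & h \in dtree_tests (s i)) (h \in family_tests s n).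
Proof.
apply: (iffP flattenP) => [[t /mapP[i + ->] hi]|[i ltin hi]].
  by rewrite mem_iota add0n => /= ltin; exists i.
by exists (dtree_tests (s i)) => //; apply/mapP; exists i => //; rewrite mem_iota.
Qed.

Lemma size_family_tests {T : Type} (s : nat -> dtree T) (n d : nat) :
  (forall i, (dtree_depth (s i) <= d)%N) -> (size (family_tests s n) <= n * 2 ^ d)%N.
Proof.
move=> sd; rewrite size_flatten /shape -map_comp sumnE big_map.
rewrite -[X in (_ <= X * _)%N](size_iota 0) -sum1_size big_distrl/=.
apply: leq_sum => i _; rewrite mul1n; apply: leq_trans (ltnW (size_dtree_tests _)) _.
by rewrite leq_exp2l.
Qed.

(** Whether a tree errs at a point depends only on membership in [c] and on the pattern over its
    tests. Hence representatives of all patterns, taken inside and outside [c], control every point,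
    and they are few enough for [halving]. *)
Lemma sparsify {T : choiceType} (H : set (set T)) (r : nat)
    (nsh : forall S : set T, (S #= `I_r)%card -> ~ shatters H S)
    (c : set T) (d n : nat) (s : nat -> dtree T) :
  (0 < n)%N -> (2 * (8 * n ^ 3 * 2 ^ d).+1 ^ (2 ^ r) < 4 ^ n)%N ->
  (forall i, dtree_based H (s i) /\ (dtree_depth (s i) <= d)%N) ->
  exists s' : nat -> dtree T, (forall i, exists j, s' i = s j) /\
    forall x, (8 * errs (misclassifies c) s' (n ^ 3) x <=
      errs (misclassifies c) s (8 * n ^ 3) x + 48 * n ^ 2)%N.
Proof.
move=> n0 small sH; set bad := misclassifies c; pose hs := family_tests s (8 * n ^ 3).
have Hhs h : h \in hs -> H h.
  by move=> /mem_family_tests[i _]; apply: dtree_based_tests; case: (sH i).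
have shs : (size hs <= 8 * n ^ 3 * 2 ^ d)%N.
  by apply: size_family_tests => i; case: (sH i).
have [L1 [sL1 L1P]] := representatives H r nsh hs Hhs c.
have [L0 [sL0 L0P]] := representatives H r nsh hs Hhs (~` c).
pose L := L1 ++ L0.
have sL : (size L < 4 ^ n)%N.
  apply: leq_ltn_trans small; rewrite size_cat mul2n -addnn; apply: leq_add.
    by apply: leq_trans sL1 _; rewrite leq_exp2r ?expn_gt0.
  by apply: leq_trans sL0 _; rewrite leq_exp2r ?expn_gt0.
have LP x : exists2 y, y \in L &
    forall i, (i < 8 * n ^ 3)%N -> bad (s i) x = bad (s i) y.
  have [y yL [cyx /eq_patternP xy]] : exists2 y, y \in L &
      (y \in c) = (x \in c) /\ pattern hs y = pattern hs x.
    have [xc|xc] := boolP (x \in c).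
      have [|y yL [yc xy]] := L1P x; first by rewrite -in_setE.
      by exists y; rewrite ?mem_cat ?yL// mem_set.
    have [|y yL [yc xy]] := L0P x; first by move=> xc'; rewrite mem_set in xc.
    by exists y; rewrite ?mem_cat ?yL ?orbT// memNset.
  exists y => // i lti; rewrite /bad /misclassifies cyx; congr (_ != _).
  by apply: eq_dtree_eval => h hi; rewrite xy//; apply/mem_family_tests; exists i.
have M1 : (2 * (n ^ 2 * (4 * n)))%N = (8 * n ^ 3)%N by lia.
have M2 : (2 * (n ^ 2 * (2 * n)))%N = (n ^ 2 * (4 * n))%N by lia.
have M3 : (2 * (n ^ 2 * n))%N = (n ^ 2 * (2 * n))%N by lia.
have M4 : (n ^ 2 * n)%N = (n ^ 3)%N by rewrite -expnSr.
(* Three halvings take [8 * n ^ 3] trees to [n ^ 3], so that the size remains a cube; each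
   contributes [16 * n ^ 2] to the final [48 * n ^ 2]. *)
have [|s1 [s1s e1]] := halving bad s L n (4 * n) n0.
  by apply: leq_trans sL _; rewrite leq_exp2l//; lia.
have [|s2 [s2s e2]] := halving bad s1 L n (2 * n) n0.
  by apply: leq_trans sL _; rewrite leq_exp2l//; lia.
have [|s3 [s3s e3]] := halving bad s2 L n n n0; first exact: sL.
(* The selected indices must stay below [8 * n ^ 3], since [L] represents points only for the tests
   of those trees. *)
have s3s' i : exists2 j, (i < n ^ 3)%N -> (j < 8 * n ^ 3)%N & s3 i = s j.
  have [i2 lt2 ->] := s3s i; have [i1 lt1 ->] := s2s i2; have [j lt ->] := s1s i1.
  exists j => // lti; rewrite -M1; apply: lt; rewrite -M2; apply: lt1.
  by rewrite -M3; apply: lt2; rewrite M4.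
exists s3; split; first by move=> i; have [j _] := s3s' i; exists j.
move=> x; have [y yL bxy] := LP x.
have -> : errs bad s3 (n ^ 3) x = errs bad s3 (n ^ 3) y.
  apply: eq_bigr => i _; have [j /(_ (ltn_ord i)) ltj ->] := s3s' i.
  by rewrite bxy.
have -> : errs bad s (8 * n ^ 3) x = errs bad s (8 * n ^ 3) y.
  by apply: eq_bigr => i _; rewrite bxy.
have := e1 y yL; have := e2 y yL; have := e3 y yL; rewrite M1 M2 M3 M4.
rewrite (_ : 4 * n * n = 4 * n ^ 2)%N; last by rewrite -mulnA.
rewrite (_ : 4 * n * (2 * n) = 8 * n ^ 2)%N; last by lia.
rewrite (_ : 4 * n * (4 * n) = 16 * n ^ 2)%N; last by lia.
set E1 := errs bad s1 _ y; set E2 := errs bad s2 _ y; set E3 := errs bad s3 _ y.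
set E := errs bad s _ y.
by move: (n ^ 2)%N E1 E2 E3 E => *; lia.
Qed.

(** The invariant says that at each point of [F] at most a fraction [1/4 + 12 / 2 ^ l] of the
    [8 ^ l] trees errs. Passing from [l + 1] to [l] costs [6 / 2 ^ l], exactly the gap between
    consecutive bounds. *)
Lemma sparsify_iter {T : choiceType} (H : set (set T)) (r : nat)
    (nsh : forall S : set T, (S #= `I_r)%card -> ~ shatters H S)
    (c : set T) (d l0 k : nat) (F : set T) (s : nat -> dtree T) :
  (forall l, (l0 <= l)%N -> (2 * (8 * (2 ^ l) ^ 3 * 2 ^ d).+1 ^ (2 ^ r) < 4 ^ (2 ^ l))%N) ->
  (forall i, dtree_based H (s i) /\ (dtree_depth (s i) <= d)%N) ->
  (forall x, F x -> (4 * 2 ^ (k + l0) * errs (misclassifies c) s (8 ^ (k + l0)) x <=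
     8 ^ (k + l0) * (2 ^ (k + l0) + 48))%N) ->
  exists s' : nat -> dtree T,
    (forall i, dtree_based H (s' i) /\ (dtree_depth (s' i) <= d)%N) /\
    forall x, F x -> (4 * 2 ^ l0 * errs (misclassifies c) s' (8 ^ l0) x <=
      8 ^ l0 * (2 ^ l0 + 48))%N.
Proof.
move=> small; elim: k s => [|k IH] s sH sF; first by exists s.
have E3 l : (8 ^ l = (2 ^ l) ^ 3)%N by rewrite -expnM mulnC expnM.
have [|s' [s's e]] := sparsify H r nsh c d (2 ^ (k + l0)) s _ (small _ (leq_addl _ _)) sH.
  by rewrite expn_gt0.
apply: (IH s') => [i|x /sF]; first by have [j ->] := s's i.
rewrite addSn (expnS 8) (expnS 2); have := e x; rewrite -E3.
have : (2 ^ (k + l0) * (2 ^ (k + l0)) ^ 2 = 8 ^ (k + l0))%N by rewrite E3 -expnS.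
set n := (2 ^ (k + l0))%N; set m := (8 ^ (k + l0))%N.
set a := errs _ s _ _; set b := errs _ s' _ _; move: n m a b => n m a b nm h1 h2.
have := leq_mul (leqnn n) h1; nia.
Qed.

(** Pattern counts are polynomial in the number of trees, while halving tolerates exponentially many
    points; the descent can thus go on down to a level fixed by [D] and [d]. *)
Lemma poly_lt_exp (D d l : nat) : (D * (8 + d) + 6 <= l)%N ->
  (2 * (8 * (2 ^ l) ^ 3 * 2 ^ d).+1 ^ D < 4 ^ (2 ^ l))%N.
Proof.
move=> le; have l2 : (l ^ 2 <= 2 ^ l)%N.
  have {le} : (4 <= l)%N by lia.
  elim: l => // l IH; rewrite leq_eqVlt => /orP[/eqP<-//|lt4l]; have {}IH := IH lt4l.
  move: IH lt4l; rewrite -!mulnn (expnS 2 l); move: (2 ^ l)%N => t; nia.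
have -> : (8 * (2 ^ l) ^ 3 * 2 ^ d = 2 ^ (3 + 3 * l + d))%N.
  by rewrite -expnM (mulnC l) !expnD.
have le1 : ((2 ^ (3 + 3 * l + d)).+1 <= 2 ^ (4 + 3 * l + d))%N.
  by rewrite ltn_exp2l.
apply: (@leq_ltn_trans (2 * (2 ^ (4 + 3 * l + d)) ^ D)).
  by rewrite leq_mul2l /=; case: (D) => // D'; rewrite leq_exp2r.
rewrite -expnM -expnS -[4%N]/(2 ^ 2)%N -expnM ltn_exp2l//.
apply: leq_ltn_trans (_ : l ^ 2 < _)%N; last by lia.
nia.
Qed.

(** * Separation by boundedly many sets *)

(** [N0] only affects where the descent starts; it always ends with [8 ^ l0] trees, whose tests are
    the separating sets. Trees cannot tell apart points of equal pattern, so if just one of the two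
    lay in [c], every tree would err at exactly one of them. *)
Lemma bounded_separation {T : choiceType} (H : set (set T)) (r : nat)
    (nsh : forall S : set T, (S #= `I_r)%card -> ~ shatters H S)
    (c : set T) (d : nat) :
  exists K : nat, forall F : set T,
    (exists N0 : nat, forall N, (N0 <= N)%N -> exists s : nat -> dtree T,
      (forall i, dtree_based H (s i) /\ (dtree_depth (s i) <= d)%N) /\
      forall x, F x -> (4 * errs (misclassifies c) s N x <= N)%N) ->
    exists hs : seq (set T), [/\ (size hs <= K)%N, forall h, h \in hs -> H h &
      forall x y, F x -> F y -> pattern hs x = pattern hs y -> c x -> c y].
Proof.
pose l0 := (2 ^ r * (8 + d) + 6)%N.
exists (8 ^ l0 * 2 ^ d)%N => F [N0 /(_ (8 ^ (N0 + l0))%N)[|s0 [s0H s0F]]].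
  by rewrite (leq_trans (leq_addr l0 N0))// ltnW// ltn_expl.
have [x /s0F|s [sH sF]] := sparsify_iter H r nsh c d l0 N0 F s0 (poly_lt_exp (2 ^ r) d) s0H.
  set m := (8 ^ _)%N; set n := (2 ^ _)%N; set e := errs _ _ _ _ => le.
  by rewrite mulnAC mulnC (leq_trans (leq_mul (leqnn n) le))// mulnC leq_mul// leq_addr.
exists (family_tests s (8 ^ l0)); split.
- by apply: size_family_tests => i; case: (sH i).
- by move=> h /mem_family_tests[i _]; apply: dtree_based_tests; case: (sH i).
move=> x y Fx Fy /eq_patternP xy cx; apply: contrapT => cy.
have : (errs (misclassifies c) s (8 ^ l0) x + errs (misclassifies c) s (8 ^ l0) y = 8 ^ l0)%N.
  rewrite /errs -big_split/= -[RHS]card_ord -sum1_card; apply: eq_bigr => i _.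
  rewrite /misclassifies mem_set// memNset// (@eq_dtree_eval _ _ x y).
    by case: dtree_eval.
  by move=> h hi; apply: xy; apply/mem_family_tests; exists i.
(* The summand [6] in [l0] serves here: the fraction [1/4 + 12 / 2 ^ l0] falls below one half, so
   the errors at [x] and [y] cannot exhaust all trees. *)
have n48 : (48 < 2 ^ l0)%N.
  by apply: (@leq_trans (2 ^ 6)) => //; rewrite leq_exp2l// leq_addl.
have m0 : (0 < 8 ^ l0)%N by rewrite expn_gt0.
have := sF x Fx; have := sF y Fy; move: (errs _ _ _ x) (errs _ _ _ y) => ex ey.
move: (2 ^ l0)%N (8 ^ l0)%N n48 m0 => n m n48 m0; nia.
Qed.

(** * Generated algebras and compactness *)

(** Induction on [hs]: split [c] along [h] and saturate each half under equality of patterns over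
    the remaining sets; intersecting with [h] or its complement recovers the half. *)
Lemma pattern_determined_algebra {T : Type} (A : set (set T)) (hs : seq (set T))
    (c : set T) :
  set_algebra A -> (forall h, h \in hs -> A h) ->
  (forall x y, pattern hs x = pattern hs y -> c x -> c y) -> A c.
Proof.
move=> [A0 AT AC AU].
have AI B D : A B -> A D -> A (B `&` D).
  by move=> AB AD; rewrite -(setCK (B `&` D)) setCI; apply/AC/AU; apply: AC.
elim: hs c => [|h hs IH] c Ahs cP.
  have [->//|/set0P[x cx]] := eqVneq c set0.
  suff -> : c = setT by [].
  by apply/seteqP; split => // y _; exact: cP cx.
have Ah : A h by apply: Ahs; rewrite mem_head.
have {}IH D : A [set x | exists2 y, (D `&` c) y & pattern hs x = pattern hs y].
  apply: IH => [g ghs|x y xy [z Dz xz]].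
    by apply: Ahs; rewrite inE ghs orbT.
  by exists z; rewrite // -xy.
rewrite [c](_ : _ = h `&` [set x | exists2 y, (h `&` c) y & pattern hs x = pattern hs y]
  `|` ~` h `&` [set x | exists2 y, (~` h `&` c) y & pattern hs x = pattern hs y]).
  by apply: AU; apply: AI => //; apply: AC.
apply/seteqP; split => x.
  by move=> cx; have [hx|hx] := pselect (h x); [left|right]; split => //; exists x.
move=> [[hx [y [hy cy] xy]]|[hx [y [hy cy] xy]]]; apply: cP cy.
  by congr (_ :: _); [rewrite !mem_set|exact/esym].
by congr (_ :: _); [rewrite !memNset|exact/esym].
Qed.

(** This is the closure in the product topology on [2 ^ T]. *)
Definition pointwise_closure {T : choiceType} (G : set (set T)) : set (set T) :=
  [set g : set T | forall L : seq T,
    exists2 h, G h & {in L, forall x, (x \in h) = (x \in g)}].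

Lemma filter_all_in {I : eqType} {U : Type} (F : set_system U) (s : seq I)
    (P : I -> set U) :
  Filter F -> (forall i, i \in s -> F (P i)) ->
  F [set u | forall i, i \in s -> P i u].
Proof.
move=> FF; elim: s => [|i s IH] FP; first by apply: filterS filterT => u _ i.
have FPs : F [set u | forall j, j \in s -> P j u].
  by apply: IH => j js; apply: FP; rewrite inE js orbT.
apply: filterS (filterI (FP i (mem_head _ _)) FPs) => u [Pi Ps] j.
by rewrite inE => /orP[/eqP->|/Ps].
Qed.

(** The [i]-th limit collects the points lying in the [i]-th set of [hs F] for almost all [F] along
    an ultrafilter of ever larger finite sets. On a finite set all [K] limits agree with the sets of
    a single large [F]. *)
Lemma separation_compactness {T : choiceType} (G : set (set T)) (K : nat) (c : set T) :
  (forall F : seq T, exists hs : seq (set T),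
    [/\ (size hs <= K)%N, forall h, h \in hs -> G h &
      forall x y, x \in F -> y \in F -> pattern hs x = pattern hs y -> c x -> c y]) ->
  exists gs : seq (set T),
    (forall g, g \in gs -> g = set0 \/ pointwise_closure G g) /\
    forall x y, pattern gs x = pattern gs y -> c x -> c y.
Proof.
move=> /choice[hs hsP].
pose Fin : set_system (seq T) :=
  filter_from [set: seq T] (fun L => [set F : seq T | {subset L <= F}]).
have FinP : ProperFilter Fin.
  apply: filter_from_proper; last by move=> L _; exists L.
  apply: filter_from_filter; first by exists [::].
  move=> L1 L2 _ _; exists (L1 ++ L2) => // F LF.
  by split=> x xL; apply: LF; rewrite mem_cat xL ?orbT.
have [U [UU FU]] := ultraFilterLemma FinP.
(* Lists shorter than [K] are padded by [set0], which is why a limit equal to [set0] is allowed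
   apart from the closure. *)
pose h F i := nth set0 (hs F) i.
pose g i := [set x | U [set F : seq T | h F i x]].
have gU i x : U [set F : seq T | (x \in h F i) = (x \in g i)].
  have [Ux|Ux] := in_ultra_setVsetC [set F : seq T | h F i x] UU.
    by apply: filterS (Ux) => F /= Fx; rewrite !mem_set.
  apply: filterS (Ux) => F /= Fx; rewrite !memNset// => Ux'.
  by have [? []] := filter_ex (filterI Ux Ux').
have gUL (L : seq T) : exists F : seq T, {subset L <= F} /\
    forall i, (i < K)%N -> {in L, forall x, (x \in h F i) = (x \in g i)}.
  have UP : U [set F : seq T | forall ix : nat * T, ix \in [seq (i, x) | i <- iota 0 K, x <- L] ->
      (ix.2 \in h F ix.1) = (ix.2 \in g ix.1)].
    by apply: filter_all_in => ix _; exact: gU.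
  have UL : U [set F : seq T | {subset L <= F}] by apply: FU; exists L.
  have [F [LF Fg]] := filter_ex (filterI UL UP); exists F; split=> // i ltiK x xL.
  by apply: (Fg (i, x)); apply/allpairsP; exists (i, x); rewrite mem_iota.
exists (mkseq g K); split.
  move=> _ /mapP[i + ->]; rewrite mem_iota add0n => /= ltiK.
  have [->|/set0P[x0 gx0]] := eqVneq (g i) set0; [by left|right] => L.
  (* Including a point [x0] of [g i] rules out padding: [h F i] contains it, hence is a genuine
     member of [hs F]. *)
  have [F [_ /(_ i ltiK) Fg]] := gUL (x0 :: L).
  exists (h F i); last by move=> x xL; apply: Fg; rewrite inE xL orbT.
  have [_ hsG _] := hsP F; apply: hsG; apply: mem_nth.
  rewrite ltnNge; apply/negP => ge.
  by have := Fg x0 (mem_head _ _); rewrite /h nth_default// memNset// mem_set.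
move=> x y /eq_patternP xy; have [F [LF Fg]] := gUL [:: x; y].
have [szK _ sep] := hsP F; apply: sep; rewrite ?LF ?inE ?eqxx ?orbT//.
apply/eq_patternP => k khs; pose i := index k (hs F).
have ltiK : (i < K)%N by apply: leq_trans szK; rewrite index_mem.
have -> : k = h F i by rewrite /h nth_index.
rewrite !Fg ?inE ?eqxx ?orbT//; apply: xy.
by apply/mapP; exists i => //; rewrite mem_iota.
Qed.

(** * Approximation by trees *)

Local Open Scope ereal_scope.

Lemma countable_enumeration {T : pointedType} : countable [set: T] ->
  exists (f : T -> nat) (e : nat -> T), cancel f e.
Proof.
move=> /countable_injP[f /in2TT f_inj].
exists f, (fun n => xget point [set x | f x = n]) => x.
by apply/f_inj/(@xgetPex _ point [set y | f y = f x]); exists x.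
Qed.

Lemma VCdim_lty {R : realType} {T : Type} (H : set (set T)) :
  VCdim R H < +oo ->
  exists r : nat, forall S : set T, (S #= `I_r)%card -> ~ shatters H S.
Proof.
move=> VCH; have [r ltr] : exists r : nat, VCdim R H < r%:R%:E.
  case: (VCdim R H) VCH => [v _| |]; [|by []|by exists 0%N; exact: ltNyr].
  exists (Num.bound `|v|); rewrite lte_fin.
  by apply: le_lt_trans (ler_norm v) _; exact: archi_boundP.
exists r => S Sr shS; move: ltr; rewrite ltNge => /negP; apply.
by apply: ereal_sup_ubound; exists r => //; exists S.
Qed.

Section interpretability.
Context {R : realType} {d : measure_display} {X : measurableType d}.
Implicit Types (P : probability X R) (t : dtree X) (A B c h : set X) (H : set (set X)).

Lemma measurable_dtree_eval {H t} : (forall h, H h -> measurable h) ->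
  dtree_based H t -> measurable [set x | dtree_eval t x].
Proof.
move=> mH; elim: t => [b _|f t1 IH1 t0 IH0 /= [/mH mf /IH1 m1 /IH0 m0]] /=.
  by case: b; [rewrite set_true|rewrite set_false].
rewrite (_ : mkset _ = f `&` [set x | dtree_eval t1 x] `|` ~` f `&` [set x | dtree_eval t0 x]).
  by apply: measurableU; apply: measurableI => //; exact: measurableC.
apply/seteqP; split => x /=.
  by case: ifPn; [rewrite in_setE; left|rewrite notin_setE; right].
by move=> [[fx]|[fx]]; rewrite ?(mem_set fx) ?(memNset fx).
Qed.

Lemma lossE P t c : loss P t c = P ([set x | dtree_eval t x] `+` c).
Proof.
rewrite /loss; congr (P _); rewrite setY_def; apply/seteqP; split => x /=.
  have [xc|xc] := pselect (c x).
    by rewrite (mem_set xc); case: dtree_eval => // _; right.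
  by rewrite (memNset xc); case: dtree_eval => // _; left.
move=> [[-> nc]|[xc /negP/negPf->]].
  by rewrite (memNset nc).
by rewrite (mem_set xc).
Qed.

Lemma setY_triangle A B c : A `+` c `<=` (A `+` B) `|` (B `+` c).
Proof.
rewrite !setY_def => x /=; have [] := pselect (B x); tauto.
Qed.

Lemma measurable_setY A B : measurable A -> measurable B -> measurable (A `+` B).
Proof. by move=> mA mB; rewrite setY_def; apply: measurableU; apply: measurableD. Qed.

(** * Approximation by trees of bounded depth *)

(** The depth is a parameter of its own, to be quantified after [P] and [e] for approximability and
    before them for uniform bounds. *)
Definition tree_approx H (k : nat) P (e : R) A : Prop :=
  exists t, [/\ dtree_based H t, (dtree_depth t <= k)%N & loss P t A <= e%:E].

(** Depths are integers: an infimum at most [n] is below [n.+1], so some admissible tree has depth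
    at most [n]. *)
Lemma depth_atP H c (e : R) P (n : nat) :
  depth_at H c e P <= n%:R%:E <-> tree_approx H n P e c.
Proof.
split=> [le|[t [tH tn te]]].
  have : depth_at H c e P < n.+1%:R%:E by apply: le_lt_trans le _; rewrite lte_fin ltr_nat.
  move=> /ereal_inf_lt[_ [t [tH te] <-]]; rewrite lte_fin ltr_nat => tn.
  by exists t.
apply: (@le_trans _ _ (dtree_depth t)%:R%:E); last by rewrite lee_fin ler_nat.
by apply: ereal_inf_lbound; exists t.
Qed.

Lemma tree_approx_near H k P (e e' : R) A B : (forall h, H h -> measurable h) ->
  measurable A -> measurable B -> P (A `+` B) <= e'%:E ->
  tree_approx H k P e A -> tree_approx H k P (e + e')%R B.
Proof.
move=> mH mA mB AB [t [tH tk]]; rewrite lossE => te; exists t; split=> //.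
have mt := measurable_dtree_eval mH tH.
rewrite lossE EFinD; apply: (@le_trans _ _ (P (([set x | dtree_eval t x] `+` A) `|` (A `+` B)))).
  apply: le_measure; rewrite ?inE.
  - exact: measurable_setY.
  - by apply: measurableU; exact: measurable_setY.
  - by move=> x; exact: setY_triangle.
apply: le_trans (measureU2 _ _ _) _; do ?apply: measurable_setY => //.
exact: leeD.
Qed.

Lemma tree_approx0 H P (e : R) : (0 <= e)%R -> tree_approx H 0 P e set0.
Proof.
move=> e0; exists (@Leaf X false); split=> //; rewrite lossE.
by rewrite (_ : mkset _ = set0) ?setYK ?measure0//; apply/seteqP; split.
Qed.

Lemma tree_approxC H k P (e : R) A : tree_approx H k P e A -> tree_approx H k P e (~` A).
Proof.
move=> [t [tH tk te]].
pose fix neg (t : dtree X) := match t with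
  | Leaf b => @Leaf X (~~ b) | Node f t1 t0 => Node f (neg t1) (neg t0) end.
have negE x u : dtree_eval (neg u) x = ~~ dtree_eval u x.
  by elim: u => [//|f u1 IH1 u0 IH0] /=; case: ifP.
exists (neg t); split.
- by elim: (t) tH => [//|f u1 IH1 u0 IH0] /= [? /IH1 ? /IH0].
- by rewrite (_ : dtree_depth (neg t) = dtree_depth t)//; elim: (t) => [//|f u1 /= -> u0 ->].
rewrite /loss; apply: le_trans te; rewrite le_eqVlt; apply/orP; left; apply/eqP.
congr (P _); apply/seteqP; split => x /=; rewrite negE in_setC;
  by case: dtree_eval; case: (x \in A).
Qed.

(** The tree [t'] is grafted onto the leaves of [t] labelled [false], so depths add. *)
Lemma tree_approxU H k k' P (e e' : R) A B : (forall h, H h -> measurable h) ->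
  measurable A -> measurable B ->
  tree_approx H k P e A -> tree_approx H k' P e' B ->
  tree_approx H (k + k') P (e + e')%R (A `|` B).
Proof.
move=> mH mA mB [t [tH tk te]] [t' [tH' tk' te']].
pose fix or (t : dtree X) := match t with
  | Leaf b => if b then @Leaf X true else t'
  | Node f t1 t0 => Node f (or t1) (or t0) end.
have orE x u : dtree_eval (or u) x = dtree_eval u x || dtree_eval t' x.
  by elim: u => [[]//|f u1 IH1 u0 IH0] /=; case: ifP.
exists (or t); split.
- by elim: (t) tH => [[]//|f u1 IH1 u0 IH0] /= [? /IH1 ? /IH0].
- apply: (@leq_trans (dtree_depth t + dtree_depth t')); last exact: leq_add.
  elim: (t) => [[]//|f u1 IH1 u0 IH0] /=; lia.
have mt := measurable_dtree_eval mH tH; have mt' := measurable_dtree_eval mH tH'.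
move: te te'; rewrite !lossE EFinD => te te'.
apply: (@le_trans _ _ (P (([set x | dtree_eval t x] `+` A) `|` ([set x | dtree_eval t' x] `+` B)))).
  have mS : measurable [set x | dtree_eval (or t) x].
    rewrite (_ : mkset _ = [set x | dtree_eval t x] `|` [set x | dtree_eval t' x]).
      exact: measurableU.
    by apply/seteqP; split => x /=; rewrite orE => /orP.
  apply: le_measure; rewrite ?inE.
  - by apply: measurable_setY => //; exact: measurableU.
  - by apply: measurableU; exact: measurable_setY.
  rewrite !setY_def => x /=; rewrite orE => Hx.
  by move: Hx; have [] := pselect (A x); have [] := pselect (B x);
    case: dtree_eval; case: dtree_eval => /=; intuition.
apply: le_trans (measureU2 _ _ _) _; do ?apply: measurable_setY => //.
exact: leeD.
Qed.

Lemma tree_approx_mem H P (e : R) h : (0 <= e)%R -> H h -> tree_approx H 1 P e h.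
Proof.
move=> e0 Hh; exists (Node h (@Leaf X true) (@Leaf X false)); split=> //.
rewrite lossE (_ : mkset _ = h) ?setYK ?measure0//.
by apply/seteqP; split => x /=; case: ifP; rewrite ?in_setE // => /negP; rewrite in_setE.
Qed.

Lemma cvg_measure_bigcap0 P (F : nat -> set X) : (forall n, measurable (F n)) ->
  {homo F : n m / (n <= m)%N >-> m `<=` n} -> \bigcap_n F n = set0 ->
  P (F n) @[n --> \oo] --> 0.
Proof.
move=> mF dF F0; rewrite -(measure0 P) -F0; apply: nonincreasing_cvg_mu => //.
- by rewrite ltey_eq fin_num_measure.
- by rewrite F0.
- by move=> n m nm; rewrite subsetEset; exact: dF.
Qed.

Lemma cvg0_exists_le (u : nat -> \bar R) (e : R) : (0 < e)%R ->
  u n @[n --> \oo] --> 0 -> exists n, u n <= e%:E.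
Proof.
move=> e0 /(_ [set y | y < e%:E])[|n _ un].
  by apply: open_ereal_lt_ereal; rewrite /= lte_fin.
by exists n; apply/ltW/un => /=.
Qed.

(** Let [h_ n] agree with [g] at the first [n] points of an enumeration. Each point lies in finitely
    many of the symmetric differences, so their tail unions decrease to the empty set and their
    measures tend to [0]. *)
Lemma pointwise_closure_clos H : countable [set: X] -> (forall h, H h -> measurable h) ->
  pointwise_closure H `<=` clos R H.
Proof.
move=> /countable_enumeration[f [e eK]] mH g gH.
have /choice[h_ h_P] (n : nat) : exists h : set X,
    H h /\ forall x, (f x < n)%N -> h x <-> g x.
  have [h Hh hg] := gH [seq e i | i <- iota 0 n].
  exists h; split=> // x fx; rewrite -(in_setE h) -(in_setE g) hg//.
  by apply/mapP; exists (f x); rewrite ?mem_iota ?eK.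
have gE : g = \bigcup_n \bigcap_(k in [set k | (n <= k)%N]) h_ k.
  apply/seteqP; split => x.
    move=> gx; exists (f x).+1 => // k /= lek; by apply/(proj2 (h_P k)).
  move=> [n _ hx]; apply/(proj2 (h_P (maxn n (f x).+1))); first exact: leq_maxr.
  by apply: hx; exact: leq_maxl.
have mh n : measurable (h_ n) by apply/mH/(h_P n).1.
have mg : measurable g.
  by rewrite gE; apply: bigcup_measurable => n _; apply: bigcap_measurable => //; exists n => /=.
split=> // P; exists h_; split; first by move=> n; case: (h_P n).
pose E n := \bigcup_(k in [set k | (n <= k)%N]) (g `+` h_ k).
have mE n : measurable (E n).
  by apply: bigcup_measurable => k _; exact: measurable_setY.
have PE0 : P (E n) @[n --> \oo] --> 0.
  apply: cvg_measure_bigcap0 => //.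
    by move=> n m nm x [k /= mk kx]; exists k => //=; exact: leq_trans mk.
  apply/seteqP; split => // x Ex; have [k /= ltk ghx] := Ex (f x).+1 I.
  by have := (h_P k).2 x ltk; move: ghx; rewrite /setY/=; tauto.
apply: (@squeeze_cvge _ _ _ R (cst 0) _ (fun n => P (E n))) PE0; last exact: cvg_cst.
apply: nearW => n; rewrite measure_ge0/=; apply: le_measure; rewrite ?inE//.
  exact: measurable_setY.
by move=> x ghx; exists n => /=.
Qed.

Lemma approximableP H c :
  approximable R H c <-> forall P (e : R), (0 < e)%R -> exists k, tree_approx H k P e c.
Proof.
split=> Hc P e e0.
  by have [t [tH te]] := Hc P e e0; exists (dtree_depth t), t.
by have [k [t [tH tk te]]] := Hc P e e0; exists t.
Qed.

(** For fixed [P] the measurable sets approximable at every accuracy form a sigma-algebra: a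
    countable union is within [e / 2] of a finite one. The depth may grow as [e] shrinks. *)
Lemma sigma_approximable H c : (forall h, H h -> measurable h) ->
  <<s H >> c -> approximable R H c.
Proof.
move=> mH Hc; apply/approximableP => P.
suff: [set A | measurable A /\ forall e : R, (0 < e)%R -> exists k, tree_approx H k P e A] c.
  by case.
move: c Hc; apply: smallest_sub; last first.
  move=> h Hh; split; first exact: mH.
  by move=> e e0; exists 1%N; apply: tree_approx_mem => //; exact: ltW.
split.
- split; first exact: measurable0.
  by move=> e e0; exists 0%N; apply/tree_approx0/ltW.
- move=> A [mA hA]; rewrite setTD; split; first exact: measurableC.
  by move=> e /hA[k kA]; exists k; exact: tree_approxC.
move=> F hF; pose G n := \bigcup_(i < n) F i.
have mF n : measurable (F n) by case: (hF n).
have mG n : measurable (G n) by apply: bigcup_measurable.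
have mU : measurable (\bigcup_n F n) by exact: bigcupT_measurable.
split=> // e e0.
have [n Ge] : exists n, P (\bigcup_n F n `\` G n) <= (e / 2)%:E.
  apply: cvg0_exists_le; first by rewrite divr_gt0.
  apply: cvg_measure_bigcap0.
  - by move=> n; exact: measurableD.
  - move=> n m nm x [xU xG]; split=> // -[k /= kn kx]; apply: xG.
    by exists k => //=; exact: leq_trans nm.
  apply/seteqP; split=> // x Hx; have [[k _ kx] _] := Hx 0%N I.
  by have [_] := Hx k.+1 I; apply; exists k => /=.
have approxG m (e' : R) : (0 < e')%R -> exists k, tree_approx H k P e' (G m).
  elim: m e' => [|m IH] e' e'0.
    by exists 0%N; rewrite /G bigcup_mkord big_ord0; apply/tree_approx0/ltW.
  have [|k1 h1] := IH (e' / 2)%R; first by rewrite divr_gt0.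
  have [|k2 h2] := (hF m).2 (e' / 2)%R; first by rewrite divr_gt0.
  exists (k1 + k2)%N; rewrite (splitr e').
  rewrite (_ : G m.+1 = G m `|` F m); first exact: tree_approxU.
  by rewrite /G !bigcup_mkord big_ord_recr.
have [|k kG] := approxG n (e / 2)%R; first by rewrite divr_gt0.
exists k; rewrite (splitr e); apply: tree_approx_near kG => //.
rewrite (_ : G n `+` _ = \bigcup_n F n `\` G n)//.
rewrite setY_def (_ : G n `\` _ = set0) ?set0U//.
by apply/seteqP; split=> // x [[k' _ k'x]]; apply; exists k'.
Qed.

(** One depth serves all [P] and [e]: it is [1] on [clos R H], and complements and finite unions
    keep it finite. The rate function is therefore constant. *)
Lemma Alg_clos_uniform H c : (forall h, H h -> measurable h) ->
  Alg (clos R H) c -> uniformly_interpretable R H c.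
Proof.
move=> mH Hc.
suff [_ [k kc]] : [set A | measurable A /\ exists k, forall P (e : R), (0 < e)%R ->
    tree_approx H k P e A] c.
  by exists (fun=> k) => P e /andP[e0 _]; apply/depth_atP; exact: kc.
move: c Hc; apply: smallest_sub; last first.
  move=> h [mh hP]; split=> //; exists 1%N => P e e0.
  have [h_ [Hh_ cvh]] := hP P; have [n nle] := cvg0_exists_le _ e e0 cvh.
  rewrite -(add0r e); apply: (tree_approx_near H _ _ _ _ (h_ n)) => //.
  - exact: mH.
  - by rewrite setYC.
  - exact: tree_approx_mem.
have cT : [set A | measurable A /\ exists k, forall P (e : R), (0 < e)%R ->
    tree_approx H k P e A] set0.
  by split=> //; exists 0%N => P e e0; apply/tree_approx0/ltW.
have cC : setC_closed [set A | measurable A /\ exists k, forall P (e : R), (0 < e)%R ->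
    tree_approx H k P e A].
  move=> A [mA [k kA]]; split; first exact: measurableC.
  by exists k => P e e0; apply/tree_approxC/kA.
split=> //; first by rewrite -setC0; exact: cC.
move=> A B [mA [k kA]] [mB [k' kB]]; split; first exact: measurableU.
exists (k + k')%N => P e e0; rewrite (splitr e).
by apply: tree_approxU => //; [apply: kA|apply: kB]; rewrite divr_gt0.
Qed.

(** * Mixtures of distributions and boosting *)

Lemma probability_of_measure (mu : {measure set X -> \bar R}) :
  0 < mu setT < +oo -> exists P, forall A, P A = mu A * (fine (mu setT))^-1%:E.
Proof.
(* [dirac point] is the default of [mnormalize] for mass [0] or [+oo], both excluded here. *)
move=> /andP[mu0 muoo]; exists (mnormalize mu (dirac point)) => A.
by rewrite /= /mnormalize gt_eqF// lt_eqF.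
Qed.

Lemma probability_of_weights (F : seq X) (w : X -> R) :
  F != [::] -> (forall x, 0 < w x)%R ->
  exists P, forall A, P A = ((\sum_(x <- F) w x * (x \in A)%:R) / \sum_(x <- F) w x)%:E.
Proof.
move=> F0 w0.
pose mu : {measure set X -> \bar R}  :=
  msum (fun i => mscale (NngNum (ltW (w0 (nth point F i)))) (dirac (nth point F i))) (size F).
have muE A : mu A = (\sum_(x <- F) w x * (x \in A)%:R)%:E.
  rewrite /mu/= /msum/= (big_nth point) big_mkord -sumEFin.
  by apply: eq_bigr => i _; rewrite /mscale/= diracE -EFinM.
have muT : mu setT = (\sum_(x <- F) w x)%:E.
  by rewrite muE; congr EFin; apply: eq_bigr => x _; rewrite in_setT mulr1.
have [|P PE] := @probability_of_measure mu.
  rewrite muT ltry andbT lte_fin; case: (F) F0 => // x s _.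
  by rewrite big_cons ltr_pwDl// sumr_ge0// => y _; exact: ltW.
by exists P => A; rewrite PE muE muT.
Qed.

(** The weighted series has total mass at most [1], so normalizing it can only enlarge its
    values. *)
Lemma probability_mixture (P_ : nat -> probability X R) :
  exists Q : probability X R, forall k A, (2 ^- k.+1)%:E * P_ k A <= Q A.
Proof.
have w0 k : (0 <= 1 / (2 ^ k.+1)%:R :> R)%R by rewrite divr_ge0.
pose m_ k := mscale (NngNum (w0 k)) (P_ k).
pose mu : {measure set X -> \bar R} := mseries m_ 0.
have term k A : (2 ^- k.+1)%:E * P_ k A = m_ k A.
  by rewrite /m_/= /mscale/= natrX mul1r.
have le_mu k A : m_ k A <= mu A.
  rewrite /mu/= /mseries; apply: le_trans (nneseries_lim_ge k.+1 _); last by [].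
  by rewrite big_nat_recr//= leeDr// sume_ge0.
have muT1 : mu setT <= 1.
  apply: le_trans (epsilon_trick0 xpredT ler01); rewrite /mu/= /mseries.
  rewrite le_eqVlt; apply/orP; left; apply/eqP.
  by apply: eq_eseriesr => k _; rewrite /m_/= /mscale/= probability_setT mule1.
have mu0 : 0 < mu setT.
  apply: lt_le_trans (le_mu 0%N setT); rewrite -term probability_setT mule1 lte_fin.
  by rewrite invr_gt0 exprn_gt0.
have [|Q QE] := @probability_of_measure mu.
  by rewrite mu0 (le_lt_trans muT1)// ltry.
exists Q => k A; rewrite QE term; apply: le_trans (le_mu k A) _.
rewrite -[leLHS]mule1; apply: lee_wpmul2l; first exact: measure_ge0.
have fmu : mu setT \is a fin_num by rewrite ge0_fin_numE// (le_lt_trans muT1)// ltry.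
have := muT1; have := mu0; rewrite -(fineK fmu) lte_fin !lee_fin => a0 a1.
by rewrite invf_ge1.
Qed.

(* If depth [k] failed at [P_ k] for every [k], then any mixture
   [Q >= \sum_k 2^-k.+1 P_ (n_ k)] would need depth above [n_ k] at accuracy
   [e 2^-k.+1]; taking [n_ k] to be the depth [f] allows there is absurd. *)
Lemma interpretable_bounded_depth H c (e : R) : interpretable R H c ->
  (0 < e <= 1)%R -> exists n, forall P, tree_approx H n P e c.
Proof.
move=> [f fP] /andP[e0 e1]; apply: contrapT => noN.
have /choice[P_ P_P] (n : nat) : exists P, ~ tree_approx H n P e c.
  by apply: contrapT => noP; apply: noN; exists n => P; apply: contrapT => nP; apply: noP; exists P.
pose eps k : R := (e * 2 ^- k.+1)%R.
have [Q QP] := probability_mixture (fun k => P_ (f (eps k))).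
have [eQ /andP[eQ0 _] fQ] := fP Q.
have i2 k : (0 < 2 ^- k.+1 :> R)%R by rewrite invr_gt0 exprn_gt0.
(* Since [k < 2 ^ k.+1], this choice brings [eps k] below [eQ], where the depth allowed by [f] is
   valid for [Q]. *)
pose k := Num.bound eQ^-1.
have keQ : (eps k <= eQ)%R.
  apply: (@le_trans _ _ (2 ^- k.+1)%R); first by rewrite -[leRHS]mul1r ler_wpM2r// ltW.
  rewrite -[leRHS]invrK lef_pV2 ?posrE ?invr_gt0 ?exprn_gt0//.
  apply: (@le_trans _ _ k%:R); first by apply/ltW/archi_boundP; rewrite invr_ge0 ltW.
  by rewrite -natrX ler_nat ltnW// (leq_trans (ltn_expl k (ltnSn 1)))// leq_exp2l.
have epsk : (0 < eps k <= eQ)%R by rewrite keQ mulr_gt0.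
have /depth_atP[t [tH tk tQ]] := fQ _ epsk.
apply: (P_P (f (eps k))); exists t; split=> //.
have := le_trans (QP k _) tQ; rewrite /eps mulrC EFinM.
by rewrite lee_pmul2l// lte_fin.
Qed.

(* Multiplicative weights: each round trains on the law proportional to
   [16 ^ errs], so the total weight grows by a factor at most [1 + 15/16]. *)
Lemma boosting H c (n : nat) (F : seq X) (N : nat) :
  (forall P, tree_approx H n P (16^-1)%R c) -> F != [::] ->
  exists s : nat -> dtree X,
    (forall i, dtree_based H (s i) /\ (dtree_depth (s i) <= n)%N) /\
    (\sum_(x <- F) 16 ^+ errs (misclassifies c) s N x <=
      (31 / 16) ^+ N * (size F)%:R :> R)%R.
Proof.
move=> weak F0; elim: N => [|N [s [sH sF]]].
  exists (fun=> @Leaf X true); split=> //.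
  rewrite expr0 mul1r -sum1_size natr_sum; apply: ler_sum => x _.
  by rewrite /errs big_ord0 expr0.
pose w x : R := (16 ^+ errs (misclassifies c) s N x)%R.
have w0 x : (0 < w x)%R by rewrite exprn_gt0.
have [P PE] := probability_of_weights F w F0 w0.
have [t [tH tn]] := weak P.
have W0 : (0 < \sum_(x <- F) w x)%R.
  by case: (F) F0 => // x r _; rewrite big_cons ltr_pwDl// sumr_ge0// => y _; exact: ltW.
rewrite /loss PE lee_fin ler_pdivrMr// => tF.
exists (fun i => if i == N then t else s i); split; first by move=> i; case: eqP.
apply: (@le_trans _ _ (31 / 16 * \sum_(x <- F) w x)%R); last first.
  rewrite exprS -[leRHS]mulrA; apply: ler_wpM2l => //; lra.
(* For a Boolean [b], [16 ^ b = 1 + 15 * b]; by [tF] the misclassified weight is at most [1 / 16] of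
   the total. *)
have -> : (\sum_(x <- F) 16 ^+ errs (misclassifies c) (fun i => if i == N then t else s i) N.+1 x =
    \sum_(x <- F) w x + 15 * \sum_(x <- F) w x * (x \in [set x | misclassifies c t x])%:R :> R)%R.
  rewrite mulr_sumr -big_split/=; apply: eq_bigr => x _.
  have -> : errs (misclassifies c) (fun i => if i == N then t else s i) N.+1 x =
      (errs (misclassifies c) s N x + misclassifies c t x)%N.
    rewrite /errs big_ord_recr /= eqxx; congr addn; apply: eq_bigr => i _.
    by rewrite ltn_eqF.
  rewrite exprD -/(w x) (_ : (x \in _) = misclassifies c t x); last first.
    by apply/idP/idP => [/set_mem//|bx]; exact: mem_set.
  by case: misclassifies => /=; rewrite ?expr1 ?expr0; lra.
move: tF; rewrite -/(misclassifies c t); lra.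
Qed.

(** A point with more than [N / 4] errors alone has weight at least [16 ^ (N / 4) = 2 ^ N], whereas
    the total weight is at most [(31 / 16) ^ N * size F], which is smaller for large [N]. *)
Lemma boosting_majority H c (n : nat) (F : seq X) :
  (forall P, tree_approx H n P (16^-1)%R c) ->
  exists N0 : nat, forall N, (N0 <= N)%N -> exists s : nat -> dtree X,
    (forall i, dtree_based H (s i) /\ (dtree_depth (s i) <= n)%N) /\
    forall x, x \in F -> (4 * errs (misclassifies c) s N x <= N)%N.
Proof.
move=> weak; have [->|F0] := eqVneq F [::].
  by exists 0%N => N _; exists (fun=> @Leaf X true).
have /cvgrPdist_lt/(_ (size F)%:R^-1%R)[|N0 _ N0P] : ((31 / 32) ^+ N)%R @[N --> \oo] --> (0%R : R).
- by apply: cvg_expr; rewrite ger0_norm; lra.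
- by rewrite invr_gt0 ltr0n; case: (F) F0.
exists N0 => N /N0P; rewrite /= sub0r normrN ger0_norm ?exprn_ge0//.
have F1 : (0 < (size F)%:R :> R)%R by rewrite ltr0n; case: (F) F0.
rewrite -[X in (_ < X)%R]mul1r ltr_pdivlMr// => small.
have [s [sH sF]] := boosting _ _ _ F N weak F0.
exists s; split=> // x xF; rewrite leqNgt; apply/negP => lt.
have : (16 ^+ errs (misclassifies c) s N x < 2 ^+ N :> R)%R.
  apply: (@le_lt_trans _ _ ((31 / 16) ^+ N * (size F)%:R)%R).
    apply: le_trans sF; rewrite (big_rem x)//= lerDl; apply: sumr_ge0 => y _.
    exact: exprn_ge0.
  rewrite (_ : 31 / 16 = 2 * (31 / 32) :> R)%R; last by lra.
  by rewrite exprMn -mulrA gtr_pMr// exprn_gt0.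
rewrite ltNge => /negP; apply.
by rewrite -!natrX ler_nat -[16%N]/(2 ^ 4)%N -expnM leq_exp2l// (ltnW lt).
Qed.

(** * Membership in the generated algebras *)

(** Under the uniform law on [x] and [y] an error at either point costs [1/2], so a tree of loss at
    most [1/4] is right at both and one of its tests tells them apart. *)
Lemma approximable_separates H c x y : approximable R H c -> c x -> ~ c y ->
  exists2 h, H h & (x \in h) != (y \in h).
Proof.
move=> approx cx cy.
have [P PE] := probability_of_weights [:: x; y] (fun=> 1%R : R) isT (fun=> ltr01).
have i4 : (0 < 4^-1 :> R)%R by rewrite invr_gt0.
have [t [tH]] := approx P _ i4.
rewrite /loss PE lee_fin !big_cons !big_nil !mul1r !addr0 ler_pdivrMr// => small.
have ok z : (z == x) || (z == y) -> dtree_eval t z = (z \in c).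
  move=> zxy; apply/eqP; apply: contraT => bad.
  have zbad : (z \in [set z | dtree_eval t z != (z \in c)]) by rewrite inE.
  exfalso; move: small; case/orP: zxy => /eqP <-; rewrite zbad /=.
    by case: (y \in _) => /=; lra.
  by case: (x \in _) => /=; lra.
apply: contrapT => nosep.
have : dtree_eval t x = dtree_eval t y.
  apply: eq_dtree_eval => h ht; apply/eqP; apply: contraT => hxy.
  by exfalso; apply: nosep; exists h => //; exact: dtree_based_tests ht.
by rewrite !ok ?eqxx ?orbT// mem_set// memNset.
Qed.

(** With [s (x, y)] containing [x] but not [y], [c] is the union over [x] in [c] of the
    intersections over [y] outside [c] of [s (x, y)]; countability makes both operations
    admissible. *)
Lemma approximable_sigma H c : countable [set: X] -> approximable R H c -> <<s H >> c.
Proof.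
move=> /countable_enumeration[f [e eK]] approx.
have [s0 sD sU] := smallest_sigma_algebra setT H.
have sC A : <<s H >> A -> <<s H >> (~` A) by move=> /sD; rewrite setTD.
have /choice[s sP] (xy : X * X) : exists S, <<s H >> S /\
    (c xy.1 -> S xy.1 /\ (~ c xy.2 -> ~ S xy.2)).
  case: xy => x y /=; have [[cx cy]|ncxy] := pselect (c x /\ ~ c y); last first.
    exists (~` set0); split; first exact: sC.
    by move=> cx; split=> // cy; exfalso; apply: ncxy.
  have [h Hh hxy] := approximable_separates _ _ _ _ approx cx cy.
  have sh : <<s H >> h by apply: sub_sigma_algebra.
  have [hx|hx] := pselect (h x).
    exists h; split=> // _; split=> // _ hy; move: hxy.
    by rewrite !mem_set.
  exists (~` h); split; first exact: sC.
  move=> _; split=> // _ hy; apply: hy; apply: contrapT => hy; move: hxy.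
  by rewrite !memNset.
(* Indices that do not qualify contribute [set0], so that both unions run over all of [nat]; the
   intersection is taken through complements. *)
pose B n m := if `[< c (e m) >] then set0 else ~` s (e n, e m).
pose A n := if `[< c (e n) >] then ~` (\bigcup_m B n m) else set0.
rewrite (_ : c = \bigcup_n A n).
  apply: (sU A) => n; rewrite /A; case: asboolP => // _.
  apply: (sC (\bigcup_m B n m)); apply: (sU (B n)) => m.
  rewrite /B; case: asboolP => // _.
  by apply: (sC (s _)); case: (sP (e n, e m)).
apply/seteqP; split => x.
  move=> cx; exists (f x) => //; rewrite /A eK asboolT// => -[m _].
  by rewrite /B eK; case: asboolP => // _; have [_ /(_ cx)[]] := sP (x, e m).
move=> [n _]; rewrite /A; case: asboolP => // cn nB; apply: contrapT => cx; apply: nB.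
exists (f x) => //; rewrite /B eK asboolF//.
by have [_ /(_ cn)[_ /(_ cx)]] := sP (e n, x).
Qed.

Lemma set_algebra_Alg (T : Type) (G : set (set T)) : set_algebra (Alg G).
Proof.
split=> [A [[]]//|A [[]]//|A GA B BG|A A' GA GA' B BG]; have [[B0 BT BC BU] _] := BG.
  by apply: BC; exact: GA.
by apply: BU; [exact: GA|exact: GA'].
Qed.

Lemma interpretable_Alg_clos H c : countable [set: X] ->
  (forall h, H h -> measurable h) -> VCdim R H < +oo ->
  interpretable R H c -> Alg (clos R H) c.
Proof.
move=> cX mH /VCdim_lty[r nsh] Hc.
have [|n weak] := interpretable_bounded_depth _ _ (16^-1)%R Hc; first by lra.
(* [K] is fixed before any finite set [F], as the compactness argument demands. *)
have [K KP] := bounded_separation H r nsh c n.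
have [F|gs [gsP sep]] := @separation_compactness X H K c.
  have [hs [shs Hhs sep]] := KP [set x | x \in F] (boosting_majority _ _ _ F weak).
  by exists hs; split.
apply: (pattern_determined_algebra _ _ _ (set_algebra_Alg X (clos R H)) _ sep) => g /gsP[->|gcl].
  by have [] := set_algebra_Alg X (clos R H).
by move=> A [_]; apply; exact: (pointwise_closure_clos H cX mH _ gcl).
Qed.

End interpretability.

Theorem theorem9 (R : realType) (d : measure_display) (X : measurableType d)
    (countableX : countable [set: X])
    (c : set X) (mc : measurable c)
    (H : set (set X)) (mH : forall h, H h -> measurable h)
    (VCH : VCdim R H < +oo) :
  [/\ approximable R H c <-> <<s H >> c,
      (approximable R H c /\ ~ interpretable R H c) <->
        (<<s H >> `\` Alg (clos R H)) c
    & uniformly_interpretable R H c <-> Alg (clos R H) c].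
Proof.
have approxP : approximable R H c <-> <<s H >> c.
  by split; [exact: approximable_sigma|exact: sigma_approximable].
(* Membership in [Alg (clos R H)], uniform interpretability and interpretability imply each other in
   a cycle, which settles the last two items. *)
have uniform_interp : uniformly_interpretable R H c -> interpretable R H c.
  by move=> [f fP]; exists f => P; exists 1%R; [rewrite ltr01 lexx|exact: fP].
have Alg_uniform := @Alg_clos_uniform R d X H c mH.
have interp_Alg := @interpretable_Alg_clos R d X H c countableX mH VCH.
split=> //; last by split=> [/uniform_interp|].
split=> -[]; first by move=> /approxP Hc nint; split=> // /Alg_uniform/uniform_interp.
by move=> /approxP Hc nAlg; split=> // /interp_Alg.
Qed.
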